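(* For all $\Sigma\cup\{\alpha\}\subseteq\mathit{Fm}$, $\Sigma\models_{\mathrm{IPWK}}\alpha$ if and only if there is $\Delta\subseteq\Sigma$ such that $\mathrm{var}(\Delta)\subseteq\mathrm{var}(\alpha)$ and $\Delta\vdash_{\mathrm{IPC}}\alpha$. Moreover, such a $\Delta\subseteq\Sigma$ can be chosen finite.
   Context: Formulas $\mathit{Fm}$ are built over a countably infinite set $V$ of variables in the language $\mathcal{L}=\{\land,\lor,\longrightarrow,\neg,0,1\}$ (arities $2,2,2,1,0,0$); $\vdash_{\mathrm{IPC}}$ is the consequence relation of intuitionistic propositional logic. Heyting algebras are regarded as $\mathcal{L}$-algebras. For a Heyting algebra $\mathbf{H}$ with universe $H$, the extended Heyting algebra $\mathbf{H}^\#=\mathbf{H}\oplus\mathbf{1}$ has universe $H\cup\{\omega\}$ ($\omega\notin H$), constants $0,1$ interpreted as in $\mathbf{H}$, and each operation of arity $n\ge1$ given by $f(a_1,\ldots,a_n)=f^{\mathbf{H}}(a_1,\ldots,a_n)$ if all $a_i\in H$ and $=\omega$ otherwise. $\Sigma\models_{\mathrm{IPWK}}\alpha$ iff for every Heyting algebra $\mathbf{H}$ and every homomorphism (valuation) $v^\#:\mathbf{Fm}\to\mathbf{H}^\#$, $v^\#[\Sigma]\subseteq\{1,\omega\}$ implies $v^\#(\alpha)\in\{1,\omega\}$. $\mathrm{var}(\varphi)$ is the set of variables of $\varphi$, $\mathrm{var}(\Delta)=\bigcup_{\delta\in\Delta}\mathrm{var}(\delta)$. *)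

(* Defs.v *)
From mathcomp Require Import all_boot.
From mathcomp Require Import boolp classical_sets functions cardinality.
Set Implicit Arguments.
Unset Strict Implicit.
Unset Printing Implicit Defensive.
Local Open Scope classical_set_scope.

Record algebra := Algebra {
  carrier :> Type;
  op_and : carrier -> carrier -> carrier;
  op_or : carrier -> carrier -> carrier;
  op_imp : carrier -> carrier -> carrier;
  op_neg : carrier -> carrier;
  op_zero : carrier;
  op_one : carrier }.

Arguments op_zero : clear implicits.
Arguments op_one : clear implicits.

Record is_hom (A B : algebra) (h : A -> B) : Prop := IsHom {
  hom_and : forall a b, h (op_and a b) = op_and (h a) (h b);
  hom_or : forall a b, h (op_or a b) = op_or (h a) (h b);
  hom_imp : forall a b, h (op_imp a b) = op_imp (h a) (h b);
  hom_neg : forall a, h (op_neg a) = op_neg (h a);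
  hom_zero : h (op_zero A) = op_zero B;
  hom_one : h (op_one A) = op_one B }.

Inductive form (V : Type) : Type :=
| Var of V
| And of form V & form V
| Or of form V & form V
| Imp of form V & form V
| Neg of form V
| Zero
| One.

Arguments Zero {V}.
Arguments One {V}.

Definition form_algebra (V : Type) : algebra :=
  Algebra (@And V) (@Or V) (@Imp V) (@Neg V) Zero One.

Fixpoint var (V : Type) (p : form V) : set V :=
  match p with
  | Var x => [set x]
  | And q r | Or q r | Imp q r => var q `|` var r
  | Neg q => var q
  | Zero | One => set0
  end.

Definition vars (V : Type) (D : set (form V)) : set V :=
  \bigcup_(d in D) var d.

Inductive ipc_axiom (V : Type) : form V -> Prop :=
| AxK p q : ipc_axiom (Imp p (Imp q p))
| AxS p q r :
    ipc_axiom (Imp (Imp p (Imp q r)) (Imp (Imp p q) (Imp p r)))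
| AxAndL p q : ipc_axiom (Imp (And p q) p)
| AxAndR p q : ipc_axiom (Imp (And p q) q)
| AxAndI p q : ipc_axiom (Imp p (Imp q (And p q)))
| AxOrL p q : ipc_axiom (Imp p (Or p q))
| AxOrR p q : ipc_axiom (Imp q (Or p q))
| AxOrE p q r :
    ipc_axiom (Imp (Imp p r) (Imp (Imp q r) (Imp (Or p q) r)))
| AxNegI p q : ipc_axiom (Imp (Imp p q) (Imp (Imp p (Neg q)) (Neg p)))
| AxNegE p q : ipc_axiom (Imp p (Imp (Neg p) q))
| AxZero p : ipc_axiom (Imp Zero p)
| AxOne : ipc_axiom One.

Inductive ipc (V : Type) (S : set (form V)) : form V -> Prop :=
| ipc_hyp p : S p -> ipc S p
| ipc_ax p : ipc_axiom p -> ipc S p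
| ipc_mp p q : ipc S (Imp p q) -> ipc S p -> ipc S q.

Definition alg_le (A : algebra) (a b : A) : Prop := op_and a b = a.

(* The one-element algebra is allowed. *)
Record is_heyting (A : algebra) : Prop := IsHeyting {
  heyting_andC : forall a b : A, op_and a b = op_and b a;
  heyting_andA : forall a b c : A,
    op_and a (op_and b c) = op_and (op_and a b) c;
  heyting_orC : forall a b : A, op_or a b = op_or b a;
  heyting_orA : forall a b c : A, op_or a (op_or b c) = op_or (op_or a b) c;
  heyting_andKor : forall a b : A, op_and a (op_or a b) = a;
  heyting_orKand : forall a b : A, op_or a (op_and a b) = a;
  heyting_le0 : forall a : A, alg_le (op_zero A) a;
  heyting_le1 : forall a : A, alg_le a (op_one A);
  heyting_residuation : forall a b c : A,
    alg_le (op_and a b) c <-> alg_le a (op_imp b c);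
  heyting_neg : forall a : A, op_neg a = op_imp a (op_zero A) }.

Definition lift1 (T : Type) (f : T -> T) (x : option T) : option T :=
  if x is Some a then Some (f a) else None.

Definition lift2 (T : Type) (f : T -> T -> T) (x y : option T) : option T :=
  if x is Some a then if y is Some b then Some (f a b) else None else None.

(* [None] is the new absorbing element omega. *)
Definition extended (A : algebra) : algebra :=
  @Algebra (option A)
    (lift2 (@op_and A)) (lift2 (@op_or A)) (lift2 (@op_imp A))
    (lift1 (@op_neg A)) (Some (op_zero A)) (Some (op_one A)).

Definition designated (A : algebra) : set (extended A) :=
  [set op_one (extended A); None].

Definition ipwk (V : Type) (S : set (form V)) (p : form V) : Prop :=
  forall (H : algebra) (v : form_algebra V -> extended H),
    is_heyting H -> is_hom v ->
    v @` S `<=` @designated H -> @designated H (v p).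

(* Main.v *)
(* Call a variable of a formula bad for a valuation into H^# when its value is
   omega; a formula takes the value omega exactly when it has a bad variable.
   From right to left, either alpha has a bad variable, or the valuation agrees
   on the formulas in var(alpha) with one into H, and IPC is sound for H.  From
   left to right, let Delta be the set of all formulas of Sigma whose variables
   occur in alpha, and send the variables of alpha to their classes in the
   Lindenbaum algebra of Delta and all the others to omega: the formulas of
   Delta take the value 1 and the rest of Sigma takes the value omega, so the
   class of alpha is 1, that is, Delta proves alpha.  Finitely many elements of
   Delta are used in such a proof. *)
Require Import Defs.
From mathcomp Require Import all_boot.
From mathcomp Require Import boolp classical_sets functions cardinality.
Set Implicit Arguments.
Unset Strict Implicit.
Unset Printing Implicit Defensive.
Local Open Scope classical_set_scope.
Local Open Scope card_scope.

(** * Valuations into an algebra and into its extension by omega *)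

Fixpoint eval {V : Type} {A : algebra} (w : V -> A) (p : form V) : A :=
  match p with
  | Var x => w x
  | And q r => op_and (eval w q) (eval w r)
  | Or q r => op_or (eval w q) (eval w r)
  | Imp q r => op_imp (eval w q) (eval w r)
  | Neg q => op_neg (eval w q)
  | Zero => op_zero A
  | One => op_one A
  end.

Lemma eval_hom (V : Type) (A : algebra) (w : V -> A) :
  @is_hom (form_algebra V) A (eval w).
Proof. by split. Qed.

(** Every operation of positive arity absorbs [None], so omega climbs from the variable to each
    formula containing it. *)
Lemma hom_extended_None (V : Type) (H : algebra)
    (v : form_algebra V -> extended H) (x : V) (p : form V) :
  is_hom v -> v (Var x) = None -> var p x -> v p = None.
Proof.
move=> [vA vO vI vN _ _] vx.
elim: p => [y|q IHq r IHr|q IHq r IHr|q IHq r IHr|q IHq||] //=.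
- by move=> <-.
- rewrite (vA q r) => -[/IHq ->//|/IHr ->]; by case: (v q).
- rewrite (vO q r) => -[/IHq ->//|/IHr ->]; by case: (v q).
- rewrite (vI q r) => -[/IHq ->//|/IHr ->]; by case: (v q).
- by rewrite (vN q) => /IHq ->.
Qed.

(** Agreement is asked only on [var p], so that [v] may take the value omega elsewhere. *)
Lemma hom_extended_Some (V : Type) (H : algebra)
    (v : form_algebra V -> extended H) (w : V -> H) (p : form V) :
  is_hom v -> (forall x, var p x -> v (Var x) = Some (w x)) ->
  v p = Some (eval w p).
Proof.
move=> [vA vO vI vN v0 v1].
elim: p => [y|q IHq r IHr|q IHq r IHr|q IHq r IHr|q IHq||] //= vw.
- exact: vw.
- by rewrite (vA q r) IHq ?IHr // => x xv; apply: vw; [right|left].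
- by rewrite (vO q r) IHq ?IHr // => x xv; apply: vw; [right|left].
- by rewrite (vI q r) IHq ?IHr // => x xv; apply: vw; [right|left].
- by rewrite (vN q) IHq.
Qed.

(** * Order-theoretic rules in a Heyting algebra *)

Section HeytingTheory.
Context {H : algebra} (HH : is_heyting H).
Implicit Types a b c d : H.

Lemma alg_le_refl a : alg_le a a.
(* Idempotence from the two absorption laws: the second [a] is expanded to
   [op_or a (op_and a a)]. *)
Proof. by rewrite /alg_le -{2}(heyting_orKand HH a a) (heyting_andKor HH). Qed.

Lemma alg_le_trans a b c : alg_le a b -> alg_le b c -> alg_le a c.
Proof. by rewrite /alg_le => <- bc; rewrite -(heyting_andA HH) bc. Qed.

Lemma alg_le_andl a b : alg_le (op_and a b) a.
Proof.
by rewrite /alg_le (heyting_andC HH) (heyting_andA HH) alg_le_refl.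
Qed.

Lemma alg_le_andr a b : alg_le (op_and a b) b.
Proof. by rewrite (heyting_andC HH); exact: alg_le_andl. Qed.

Lemma alg_le_and a b c : alg_le a b -> alg_le a c -> alg_le a (op_and b c).
Proof. by rewrite /alg_le => ab ac; rewrite (heyting_andA HH) ab ac. Qed.

Lemma alg_le_orl a b : alg_le a (op_or a b).
Proof. exact: (heyting_andKor HH). Qed.

Lemma alg_le_orr a b : alg_le b (op_or a b).
Proof. by rewrite (heyting_orC HH); exact: alg_le_orl. Qed.

Lemma alg_le_orE a c : alg_le a c -> op_or a c = c.
Proof.
move=> ac.
by rewrite (heyting_orC HH) -{1}ac (heyting_andC HH) (heyting_orKand HH).
Qed.

Lemma alg_le_or a b c : alg_le a c -> alg_le b c -> alg_le (op_or a b) c.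
Proof.
move=> /alg_le_orE ac /alg_le_orE bc.
(* The bound [c] is rewritten as the join of [op_or a b] and [c], and absorption applies. *)
rewrite /alg_le -{1}ac -{1}bc (heyting_orA HH a) (heyting_orC HH _ c).
have -> : op_or c (op_or a b) = op_or (op_or a b) c by rewrite (heyting_orC HH).
by rewrite (heyting_andKor HH).
Qed.

Lemma alg_le_imp a b c : alg_le (op_and a b) c -> alg_le a (op_imp b c).
Proof. by move/(heyting_residuation HH). Qed.

(** Modus ponens with [d] in the role of a context. *)
Lemma alg_le_mp d a b : alg_le d (op_imp a b) -> alg_le d a -> alg_le d b.
Proof.
move=> /(heyting_residuation HH) dab da; apply: alg_le_trans dab.
by apply: alg_le_and => //; exact: alg_le_refl.
Qed.

Lemma alg_le_neg a b : alg_le (op_and a b) (op_zero H) -> alg_le a (op_neg b).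
Proof. by rewrite (heyting_neg HH); exact: alg_le_imp. Qed.

Lemma alg_le_negE d a : alg_le d (op_neg a) -> alg_le d a ->
  alg_le d (op_zero H).
Proof. by rewrite (heyting_neg HH); exact: alg_le_mp. Qed.

Lemma alg_le1_eq a : alg_le (op_one H) a -> a = op_one H.
Proof.
move=> a1; rewrite -[RHS]a1 (heyting_andC HH); symmetry.
exact: (heyting_le1 HH).
Qed.

Lemma alg_le_weaken c a b : alg_le a b -> alg_le (op_and a c) b.
Proof. exact/alg_le_trans/alg_le_andl. Qed.

End HeytingTheory.

(** * Soundness of IPC, and finiteness of derivations *)

Lemma ipc_axiom_sound (V : Type) (H : algebra) (w : V -> H) (p : form V) :
  is_heyting H -> ipc_axiom p -> eval w p = op_one H.
Proof.
(* Residuation moves the premises of each axiom into a meet below which the conclusion is derived;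
   projections recover the premises. *)
move=> HH px; apply: (alg_le1_eq HH); case: px => {p} /=.
- by move=> p q; do 2![apply: alg_le_imp => //]; apply: alg_le_weaken => //;
    exact: alg_le_andr.
- move=> p q r; do 3![apply: alg_le_imp => //].
  set d := op_and _ (eval w p).
  have dp : alg_le d (eval w p) by exact: alg_le_andr.
  apply: (@alg_le_mp _ HH _ (eval w q)).
    apply: (alg_le_mp HH _ dp); apply: alg_le_weaken => //.
    by apply: alg_le_weaken => //; exact: alg_le_andr.
  by apply: (alg_le_mp HH _ dp); apply: alg_le_weaken => //; exact: alg_le_andr.
- move=> p q; apply: alg_le_imp => //.
  apply: (alg_le_trans HH (alg_le_andr HH _ _)); exact: alg_le_andl.
- move=> p q; apply: alg_le_imp => //.
  apply: (alg_le_trans HH (alg_le_andr HH _ _)); exact: alg_le_andr.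
- move=> p q; do 2![apply: alg_le_imp => //]; apply: alg_le_and => //.
    by apply: alg_le_weaken => //; exact: alg_le_andr.
  exact: alg_le_andr.
- move=> p q; apply: alg_le_imp => //.
  apply: (alg_le_trans HH (alg_le_andr HH _ _)); exact: alg_le_orl.
- move=> p q; apply: alg_le_imp => //.
  apply: (alg_le_trans HH (alg_le_andr HH _ _)); exact: alg_le_orr.
- move=> p q r; do 3![apply: alg_le_imp => //].
  (* The disjunction is brought to the left and the other premises are moved back to the right, so
     that [alg_le_or] can split it. *)
  rewrite (heyting_andC HH); apply/(heyting_residuation HH).
  by apply: alg_le_or => //; apply: alg_le_imp => //;
    rewrite (heyting_andC HH); apply/(heyting_residuation HH);
    [apply: alg_le_weaken => //|]; exact: alg_le_andr.
- move=> p q; do 2![apply: alg_le_imp => //]; apply: alg_le_neg => //.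
  set d := op_and _ (eval w p).
  have dp : alg_le d (eval w p) by exact: alg_le_andr.
  apply: (@alg_le_negE _ HH _ (eval w q)); apply: (alg_le_mp HH _ dp).
    by apply: alg_le_weaken => //; exact: alg_le_andr.
  by do 2![apply: alg_le_weaken => //]; exact: alg_le_andr.
- move=> p q; do 2![apply: alg_le_imp => //].
  apply: (alg_le_trans HH _ (heyting_le0 HH _)).
  apply: (alg_le_negE HH (alg_le_andr HH _ _)).
  by apply: alg_le_weaken => //; exact: alg_le_andr.
- move=> p; apply: alg_le_imp => //.
  exact: (alg_le_trans HH (alg_le_andr HH _ _) (heyting_le0 HH _)).
- exact: alg_le_refl.
Qed.

Lemma ipc_sound (V : Type) (S : set (form V)) (H : algebra) (w : V -> H)
    (p : form V) :
  is_heyting H -> (forall q, S q -> eval w q = op_one H) ->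
  ipc S p -> eval w p = op_one H.
Proof.
move=> HH S1; elim=> {p} [p /S1//|p|p q _ /= pq _ p1].
  exact: ipc_axiom_sound.
apply: (alg_le1_eq HH); apply: (alg_le_mp HH (a := eval w p)).
  by rewrite pq; exact: alg_le_refl.
by rewrite p1; exact: alg_le_refl.
Qed.

Lemma ipc_sub (V : Type) (S T : set (form V)) (p : form V) :
  S `<=` T -> ipc S p -> ipc T p.
Proof.
move=> ST; elim=> {p} [p /ST|p|p q _ pq _].
- exact: ipc_hyp.
- exact: ipc_ax.
- exact: ipc_mp pq.
Qed.

(** A derivation is a finite tree; the hypotheses at its leaves are collected. *)
Lemma ipc_finite (V : Type) (S : set (form V)) (p : form V) :
  ipc S p -> exists D, [/\ finite_set D, D `<=` S & ipc D p].
Proof.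
elim=> {p} [p Sp|p px|p q _ [D [Df DS Dpq]] _ [E [Ef ES Ep]]].
- exists [set p]; split; [exact: finite_set1|by move=> _ ->|exact: ipc_hyp].
- exists set0; split; [exact: finite_set0|by []|exact: ipc_ax].
- exists (D `|` E); split.
  + by rewrite finite_setU.
  + by rewrite subUset.
  + by apply: (@ipc_mp _ _ p); [apply: ipc_sub Dpq|apply: ipc_sub Ep];
      move=> x Dx; [left|right].
Qed.

(** * The derivability preorder on formulas *)

Section Entailment.
Context {V : Type} (S : set (form V)).
Implicit Types p q r : form V.

Definition entails p q := ipc S (Imp p q).

Lemma entails_K p q : ipc S q -> entails p q.
Proof. by apply: ipc_mp; apply: ipc_ax; exact: AxK. Qed.

(** With [entails_K], this replaces the deduction theorem: axioms K and S carry derivations under a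
    hypothesis [p]. *)
Lemma entails_mp p q r : entails p (Imp q r) -> entails p q -> entails p r.
Proof.
by move=> pqr; apply: ipc_mp; apply: ipc_mp pqr; apply: ipc_ax; exact: AxS.
Qed.

Lemma entails_refl p : entails p p.
Proof.
by apply: (@entails_mp _ (Imp p p)); apply: ipc_ax; exact: AxK.
Qed.

Lemma entails_trans p q r : entails p q -> entails q r -> entails p r.
Proof. by move=> pq qr; apply: entails_mp pq; exact: entails_K. Qed.

Lemma entails_andl p q : entails (And p q) p.
Proof. by apply: ipc_ax; exact: AxAndL. Qed.

Lemma entails_andr p q : entails (And p q) q.
Proof. by apply: ipc_ax; exact: AxAndR. Qed.

Lemma entails_and p q r : entails p q -> entails p r -> entails p (And q r).
Proof.
move=> pq; apply: entails_mp; apply: entails_mp pq; apply: entails_K.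
by apply: ipc_ax; exact: AxAndI.
Qed.

Lemma entails_orl p q : entails p (Or p q).
Proof. by apply: ipc_ax; exact: AxOrL. Qed.

Lemma entails_orr p q : entails q (Or p q).
Proof. by apply: ipc_ax; exact: AxOrR. Qed.

Lemma entails_or p q r : entails p r -> entails q r -> entails (Or p q) r.
Proof.
by move=> pr; apply: ipc_mp; apply: ipc_mp pr; apply: ipc_ax; exact: AxOrE.
Qed.

Lemma entails_imp p q r : entails (And p q) r <-> entails p (Imp q r).
Proof.
split=> [pqr|pqr]; last first.
  apply: entails_mp (entails_andr p q).
  exact: entails_trans (entails_andl p q) pqr.
have pq : entails p (Imp q (And p q)) by apply: ipc_ax; exact: AxAndI.
(* Under [p], axiom S composes [Imp q (And p q)] with the given implication from [And p q] to
   [r]. *)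
apply: entails_mp pq; apply: (@entails_mp _ (Imp q (Imp (And p q) r))).
  by apply: entails_K; apply: ipc_ax; exact: AxS.
by do 2![apply: entails_K].
Qed.

Lemma entails0 p : entails Zero p.
Proof. by apply: ipc_ax; exact: AxZero. Qed.

Lemma entails1 p : entails p One.
Proof. by apply: entails_K; apply: ipc_ax; exact: AxOne. Qed.

Lemma entails_neg p q : entails p (Neg q) <-> entails p (Imp q Zero).
Proof.
split=> h.
  apply/entails_imp; apply: (@entails_mp _ (Neg q)).
    apply: entails_mp (entails_andr p q); apply: entails_K.
    by apply: ipc_ax; exact: AxNegE.
  exact: entails_trans (entails_andl p q) h.
(* [AxNegI] is used with [Zero] as the refuted formula; its second premise holds because [Neg Zero]
   is itself derivable. *)
apply: (@entails_mp _ (Imp q (Neg Zero))).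
  apply: entails_mp h; apply: entails_K.
  by apply: ipc_ax; exact: AxNegI.
apply: entails_K; apply: entails_K.
apply: ipc_mp (entails0 (Neg Zero)); apply: ipc_mp (entails0 Zero).
by apply: ipc_ax; exact: AxNegI.
Qed.

End Entailment.

(** * The Lindenbaum algebra of a set of formulas *)

Section Lindenbaum.
Context {V : Type} (S : set (form V)).
Implicit Types p q r : form V.

(* The class of [p] is represented by the set of its consequences. *)
Definition lind_sort : Type :=
  {X : set (form V) | exists p, X = [set q | entails S p q]}.

Definition lind_class p : lind_sort := exist _ _ (ex_intro _ p erefl).

Lemma lind_classP p q :
  lind_class p = lind_class q <-> entails S p q /\ entails S q p.
Proof.
split=> [/(congr1 sval)/= pq|[pq qp]].
  have /= h r : entails S p r = entails S q r := congr1 (fun X => X r) pq.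
  by split; [rewrite h|rewrite -h]; exact: entails_refl.
apply: eq_exist; apply/seteqP; split=> r /=; exact: entails_trans.
Qed.

Lemma lind_class_surj (X : lind_sort) : exists p, lind_class p = X.
Proof. by case: X => X [p pX]; exists p; apply: eq_exist; rewrite pX. Qed.

Definition lind_repr (X : lind_sort) : form V := sval (cid (lind_class_surj X)).

Lemma lind_reprK (X : lind_sort) : lind_class (lind_repr X) = X.
Proof. exact: svalP (cid (lind_class_surj X)). Qed.

Lemma lind_repr_entails p :
  entails S (lind_repr (lind_class p)) p /\
  entails S p (lind_repr (lind_class p)).
Proof. exact/lind_classP/lind_reprK. Qed.

(** Operations act on chosen representatives; [lind_andE], [lind_orE] and [lind_impE] show that the
    choice is immaterial. *)
Definition lind2 (f : form V -> form V -> form V) (X Y : lind_sort) :=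
  lind_class (f (lind_repr X) (lind_repr Y)).

Definition lindenbaum : algebra :=
  @Algebra lind_sort (lind2 (@And V)) (lind2 (@Or V)) (lind2 (@Imp V))
    (fun X => lind_class (Neg (lind_repr X))) (lind_class Zero)
    (lind_class One).

Lemma lind_andE p q :
  @op_and lindenbaum (lind_class p) (lind_class q) = lind_class (And p q).
Proof.
have [p1 p2] := lind_repr_entails p; have [q1 q2] := lind_repr_entails q.
by apply/lind_classP; split; apply: entails_and;
  [apply: entails_trans p1|apply: entails_trans q1
  |apply: entails_trans p2|apply: entails_trans q2];
  (exact: entails_andl || exact: entails_andr).
Qed.

Lemma lind_orE p q :
  @op_or lindenbaum (lind_class p) (lind_class q) = lind_class (Or p q).
Proof.
have [p1 p2] := lind_repr_entails p; have [q1 q2] := lind_repr_entails q.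
by apply/lind_classP; split; apply: entails_or;
  [apply: entails_trans p1 _|apply: entails_trans q1 _
  |apply: entails_trans p2 _|apply: entails_trans q2 _];
  (exact: entails_orl || exact: entails_orr).
Qed.

Lemma entails_imp_mono p p' q q' : entails S p' p -> entails S q q' ->
  entails S (Imp p q) (Imp p' q').
Proof.
move=> pp qq; apply/entails_imp; apply: entails_trans qq.
apply: (@entails_mp _ _ _ p); first exact: entails_andl.
by apply: entails_trans pp; exact: entails_andr.
Qed.

Lemma lind_impE p q :
  @op_imp lindenbaum (lind_class p) (lind_class q) = lind_class (Imp p q).
Proof.
have [p1 p2] := lind_repr_entails p; have [q1 q2] := lind_repr_entails q.
by apply/lind_classP; split; exact: entails_imp_mono.
Qed.

Lemma lind_neg_imp p : lind_class (Neg p) = lind_class (Imp p Zero).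
Proof.
by apply/lind_classP; split; apply/entails_neg; exact: entails_refl.
Qed.

Lemma lind_negE p : @op_neg lindenbaum (lind_class p) = lind_class (Neg p).
Proof.
(* Independence of the representative is inherited from [Imp], negation being implication of [Zero]
   up to equivalence. *)
by rewrite /= !lind_neg_imp -!lind_impE lind_reprK.
Qed.

Lemma lind_leE p q :
  @alg_le lindenbaum (lind_class p) (lind_class q) <-> entails S p q.
Proof.
rewrite /alg_le lind_andE; split=> [/lind_classP[_ ppq]|pq].
  exact: entails_trans ppq (entails_andr S p q).
apply/lind_classP; split; first exact: entails_andl.
by apply: entails_and => //; exact: entails_refl.
Qed.

Lemma lindenbaum_heyting : is_heyting lindenbaum.
Proof.
have al := entails_andl S; have ar := entails_andr S.
have ol := entails_orl S; have or_ := entails_orr S.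
have tr := @entails_trans V S.
split.
- move=> a b; have [p <-] := lind_class_surj a.
  have [q <-] := lind_class_surj b.
  by rewrite !lind_andE; apply/lind_classP; split; exact: entails_and.
- move=> a b c; have [p <-] := lind_class_surj a.
  have [q <-] := lind_class_surj b; have [r <-] := lind_class_surj c.
  rewrite !lind_andE; apply/lind_classP; split.
    by do ?[apply: entails_and]; eauto.
  by do ?[apply: entails_and]; eauto.
- move=> a b; have [p <-] := lind_class_surj a.
  have [q <-] := lind_class_surj b.
  by rewrite !lind_orE; apply/lind_classP; split; exact: entails_or.
- move=> a b c; have [p <-] := lind_class_surj a.
  have [q <-] := lind_class_surj b; have [r <-] := lind_class_surj c.
  rewrite !lind_orE; apply/lind_classP; split.
    by do ?[apply: entails_or]; eauto.
  by do ?[apply: entails_or]; eauto.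
- move=> a b; have [p <-] := lind_class_surj a.
  have [q <-] := lind_class_surj b.
  by rewrite lind_orE; apply/lind_leE.
- move=> a b; have [p <-] := lind_class_surj a.
  have [q <-] := lind_class_surj b.
  rewrite lind_andE lind_orE; apply/lind_classP; split=> //.
  by apply: entails_or => //; exact: entails_refl.
- move=> a; have [p <-] := lind_class_surj a.
  by apply/lind_leE; exact: entails0.
- move=> a; have [p <-] := lind_class_surj a.
  by apply/lind_leE; exact: entails1.
- move=> a b c; have [p <-] := lind_class_surj a.
  have [q <-] := lind_class_surj b; have [r <-] := lind_class_surj c.
  rewrite lind_andE lind_impE; split=> /lind_leE h; apply/lind_leE.
    exact/entails_imp.
  exact/entails_imp.
- move=> a; have [p <-] := lind_class_surj a.
  by rewrite lind_negE lind_neg_imp -lind_impE.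
Qed.

(** Truth lemma for the canonical valuation. *)
Lemma lind_eval p :
  @eval _ lindenbaum (fun x => lind_class (Var x)) p = lind_class p.
Proof.
elim: p => [//|p IHp q IHq|p IHp q IHq|p IHp q IHq|p IHp|//|//];
  rewrite [LHS]/= IHp ?IHq.
- exact: lind_andE.
- exact: lind_orE.
- exact: lind_impE.
- exact: lind_negE.
Qed.

Lemma lind_class1 p : lind_class p = lind_class One <-> ipc S p.
Proof.
rewrite lind_classP; split=> [[_]|Sp]; last first.
  by split; [exact: entails1|exact: entails_K].
by move/ipc_mp; apply; apply: ipc_ax; exact: AxOne.
Qed.

End Lindenbaum.

(** * The two directions of the characterization *)

Lemma ipc_ipwk (V : Type) (Sigma Delta : set (form V)) (alpha : form V) :
  Delta `<=` Sigma -> vars Delta `<=` var alpha -> ipc Delta alpha ->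
  ipwk Sigma alpha.
Proof.
move=> DS Dvar Dalpha H v HH hv vS.
have [[x ax vx]|no_None] :=
    pselect (exists2 x, var alpha x & v (Var x) = None).
  by right; exact: hom_extended_None hv vx ax.
(* The default is reached only at variables outside [alpha], as no variable of [alpha] is bad
   here. *)
pose w x : H := odflt (op_one H) (v (Var x)).
have vw p : var p `<=` var alpha -> v p = Some (eval w p).
  move=> pa; apply: hom_extended_Some => // x /pa ax; rewrite /w.
  by case E: (v (Var x)) => //; case: no_None; exists x.
left; rewrite vw //=; congr Some; apply: (ipc_sound HH _ Dalpha).
move=> q Dq; have /vS : (v @` Sigma) (v q) by exists q => //; exact: DS.
have -> : v q = Some (eval w q).
  by apply: vw => x qx; apply: Dvar; exists q.
(* As [v q] is not omega, being designated forces it to be 1. *)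
by case=> // -[].
Qed.

Lemma ipwk_ipc (V : Type) (Sigma : set (form V)) (alpha : form V) :
  ipwk Sigma alpha -> ipc [set s | Sigma s /\ var s `<=` var alpha] alpha.
Proof.
set D := [set s | _]; move=> Salpha.
pose u (x : V) : extended (lindenbaum D) :=
  if `[< var alpha x >] then Some (lind_class D (Var x)) else None.
have hu := eval_hom u.
have uE p : var p `<=` var alpha -> eval u p = Some (lind_class D p).
  move=> pa; rewrite -lind_eval; apply: hom_extended_Some => // x /pa ax.
  by rewrite /= /u asboolT.
have : @designated (lindenbaum D) (eval u alpha).
  apply: (Salpha _ _ (lindenbaum_heyting D) hu) => _ [s Ss <-].
  have [sa|/existsNP[x /not_implyP[sx ax]]] := pselect (var s `<=` var alpha).
    left; rewrite uE //=; congr Some.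
    by apply/lind_class1; apply: ipc_hyp; split.
  right; apply: hom_extended_None hu _ sx.
  by rewrite /= /u asboolF.
(* All variables of [alpha] have values in the Lindenbaum algebra, so omega is excluded and the
   class of [alpha] is 1. *)
by rewrite uE // => -[/Some_inj/lind_class1|].
Qed.

Theorem theorem4p6 (V : Type) (V_countably_infinite : [set: V] #= [set: nat])
    (Sigma : set (form V)) (alpha : form V) :
  (ipwk Sigma alpha <->
     exists Delta : set (form V),
       [/\ Delta `<=` Sigma, vars Delta `<=` var alpha & ipc Delta alpha]) /\
  (ipwk Sigma alpha ->
     exists Delta : set (form V),
       [/\ finite_set Delta, Delta `<=` Sigma, vars Delta `<=` var alpha
         & ipc Delta alpha]).
Proof.
(* A finite set serves both the equivalence and the final claim; its variables stay within [alpha]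
   because it is a subset of the canonical choice. *)
have finite_Delta : ipwk Sigma alpha -> exists Delta : set (form V),
    [/\ finite_set Delta, Delta `<=` Sigma, vars Delta `<=` var alpha
      & ipc Delta alpha].
  move=> /ipwk_ipc/ipc_finite[D [Df DS Da]]; exists D; split=> //.
    by move=> s /DS[].
  by move=> x [s /DS[_]]; apply.
split=> //; split=> [/finite_Delta[D [_ ? ? ?]]|[D [DS Dvar Da]]].
  by exists D.
exact: ipc_ipwk Da.
Qed.
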